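(* Let $\pi$ be a probability density on $\mathbb{R}^d$ with $\pi(x)>0$ for all $x$ and $\log\pi\in C^1(\mathbb{R}^d)$, and assume: (i) there is $\gamma>0$ such that $\liminf_{|x_1|\to\infty}\Big(\inf_{(x_2,\dots,x_d)\in\mathbb{R}^{d-1}}\big|\frac{\partial\log\pi(x)}{\partial x_1}\big|\,\|x\|_2^{\gamma}\Big)>0$; (ii) for $X\sim\pi$ there is $\beta>0$ such that $\limsup_{t\to\infty}\mathbb{P}(\|X\|_2>t)\,e^{t^\beta}<\infty$. For $\lambda>0$ let $\pi^{(\lambda)}(x):=\lambda^{-1}\pi(x_1/\lambda,x_2,\dots,x_d)$, fix $\sigma>0$, and let $P^M_\lambda$ be the Metropolis--Hastings kernel with target $\pi^{(\lambda)}$ and candidate kernel $N\big(x+\frac{\sigma^2}{2}\nabla\log\pi^{(\lambda)}(x),\sigma^2\mathbb{I}_d\big)$. Then there exists $\alpha>0$ such that $\limsup_{\lambda\downarrow0}\mathrm{Gap}(P^M_\lambda)\,e^{\lambda^{-\alpha}}<\infty$, and $\alpha$ can be taken as $\alpha=\min\{\beta/2,\beta/\gamma,2/3\}$.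
   Context: Metropolis--Hastings kernel with target density $\pi$ and candidate kernel $Q(x,dy)=q(x,y)dy$: $P(x,dy)=\alpha(x,y)Q(x,dy)+r(x)\delta_x(dy)$ with acceptance probability $\min\{1,\pi(y)q(y,x)/(\pi(x)q(x,y))\}$ and $r(x)$ the rejection probability. $\mathrm{Gap}(P)=\inf_{f\in L^2_{0,1}(\pi)}\frac12\int (f(y)-f(x))^2\pi(dx)P(x,dy)$ with $L^2_{0,1}(\pi)=\{f:\mathbb{E}_\pi f=0,\mathrm{Var}_\pi f=1\}$. *)

(* Defs.v *)
From HB Require Import structures.
From mathcomp Require Import all_boot all_order all_algebra.
From mathcomp Require Import all_classical all_reals all_analysis.
Set Implicit Arguments. Unset Strict Implicit. Unset Printing Implicit Defensive.
Import Order.TTheory GRing.Theory Num.Theory.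
Import numFieldNormedType.Exports.
Local Open Scope classical_set_scope.
Local Open Scope ring_scope.

Section Defs.
Variable R : realType.

Definition norm2 (d : nat) (x : 'rV[R]_d) : R := Num.sqrt (\sum_(i < d) x ord0 i ^+ 2).

Definition e1 (d : nat) : 'rV[R]_d := \row_(i < d) ((val i == 0)%N)%:R.
Definition ei (d : nat) (i : 'I_d) : 'rV[R]_d := \row_(j < d) (j == i)%:R.

Definition grad (d : nat) (f : 'rV[R]_d -> R) (x : 'rV[R]_d) : 'rV[R]_d :=
  \row_(i < d) 'D_(ei i) f x.

Definition C1 (d : nat) (f : 'rV[R]_d -> R) : Prop :=
  (forall x, differentiable f x) /\ (forall v, continuous (fun x => 'D_v f x)).

Definition measurable_Rd (d : nat) (f : 'rV[R]_d -> R) : Prop :=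
  forall B : set R, measurable B ->
    (@open 'rV[R]_d).-sigma.-measurable (f @^-1` B).

(* Lebesgue integral on R^d as the iterated Lebesgue integral over the coordinates *)
Fixpoint iter_int (n : nat) (F : (nat -> R) -> \bar R) : \bar R :=
  match n with
  | 0%N => F (fun _ => 0)
  | n'.+1 => (\int[@lebesgue_measure R]_t
                 iter_int n' (fun x => F (fun i => if i == n' then t else x i)))%E
  end.

Definition intRd (d : nat) (g : 'rV[R]_d -> \bar R) : \bar R :=
  iter_int d (fun x => g (\row_(i < d) x (val i))).


Definition mh_acc (d : nat) (p : 'rV[R]_d -> R) (q : 'rV[R]_d -> 'rV[R]_d -> R)
  (x y : 'rV[R]_d) : R := Num.min 1 (p y * q y x / (p x * q x y)).

Definition mh_rej (d : nat) (p : 'rV[R]_d -> R) (q : 'rV[R]_d -> 'rV[R]_d -> R)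
  (x : 'rV[R]_d) : \bar R :=
  (1 - intRd (fun y => (mh_acc p q x y * q x y)%:E))%E.

(* integral of a nonnegative g against P(x, dy) = alpha(x,y) q(x,y) dy + r(x) delta_x(dy) *)
Definition mh_kernel_int (d : nat) (p : 'rV[R]_d -> R) (q : 'rV[R]_d -> 'rV[R]_d -> R)
  (x : 'rV[R]_d) (g : 'rV[R]_d -> \bar R) : \bar R :=
  (intRd (fun y => (mh_acc p q x y * q x y)%:E * g y) + mh_rej p q x * g x)%E.

(* L^2_{0,1}(pi): measurable f with E_pi f = 0 (written as E f^+ = E f^-) and Var_pi f = 1 *)
Definition L2_01 (d : nat) (p : 'rV[R]_d -> R) (f : 'rV[R]_d -> R) : Prop :=
  [/\ measurable_Rd f,
      intRd (fun x => (Num.max (f x) 0 * p x)%:E) =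
      intRd (fun x => (Num.max (- f x) 0 * p x)%:E) &
      intRd (fun x => (f x ^+ 2 * p x)%:E) = 1%E ].

Definition dirichlet (d : nat) (p : 'rV[R]_d -> R) (q : 'rV[R]_d -> 'rV[R]_d -> R)
  (f : 'rV[R]_d -> R) : \bar R :=
  ((2^-1)%:E * intRd (fun x => (p x)%:E *
      mh_kernel_int p q x (fun y => ((f y - f x) ^+ 2)%:E)))%E.

Definition Gap (d : nat) (p : 'rV[R]_d -> R) (q : 'rV[R]_d -> 'rV[R]_d -> R) : \bar R :=
  ereal_inf [set dirichlet p q f | f in L2_01 p].

Definition gauss_density (d : nat) (s : R) (m y : 'rV[R]_d) : R :=
  powR (2 * pi * s ^+ 2) (- (d%:R / 2)) * expR (- (norm2 (y - m) ^+ 2) / (2 * s ^+ 2)).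

Definition mala_q (d : nat) (s : R) (p : 'rV[R]_d -> R) (x y : 'rV[R]_d) : R :=
  gauss_density s (x + (s ^+ 2 / 2) *: grad (fun z => ln (p z)) x) y.

Definition scaled_density (d : nat) (lam : R) (p : 'rV[R]_d -> R) (x : 'rV[R]_d) : R :=
  lam^-1 * p (\row_(i < d) (if val i == 0%N then x ord0 i / lam else x ord0 i)).

End Defs.

(* Main.v *)
Require Import Defs.
From HB Require Import structures.
From mathcomp Require Import all_boot all_order all_algebra.
From mathcomp Require Import all_classical all_reals all_analysis.
From mathcomp Require Import measurable_realfun ring lra.
Set Implicit Arguments.
Unset Strict Implicit.
Unset Printing Implicit Defensive.
Import Order.TTheory GRing.Theory Num.Theory.
Import numFieldNormedType.Exports.
Local Open Scope classical_set_scope.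
Local Open Scope ring_scope.

(* Pick a point [x0] where the first partial derivative of [ln p] does not
   vanish, and a small box [A0] around it on which that derivative stays away
   from [0].  Let [A] be the image of [A0] under the contraction
   [x_1 |-> lam x_1]; its mass [m] under the scaled target does not depend on
   [lam].  The Langevin drift is of order [1 / lam] on [A], hence a proposal
   from [A] reaches the points [y] with [norm2 (S y) <= 1 / lam]
   ([S] undoing the contraction) with density at most
   [K exp (- kappa / lam^2)], on a region of polynomial volume; the remaining
   points have mass [O (exp (- lam^-beta))].  Since
   [pi x * acc x y * q x y = min (pi x * q x y) (pi y * q y x)], each pair with
   exactly one point in [A] is controlled by one of these two bounds, so the
   normalised indicator of [A] has Dirichlet form
   [O (exp (- lam^-beta) + lam^-d exp (- kappa / lam^2))], which is smaller than
   [exp (- lam^-alpha)]. *)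

(** * Iterated Lebesgue integrals *)

Section IteratedIntegral.
Context {R : realType}.
Local Notation mu := (@lebesgue_measure R).
Local Open Scope ereal_scope.

(** The integral of a nonnegative function is a supremum over the simple functions below it, so
    monotonicity needs no measurability. This lets the Dirichlet integrand be bounded without
    proving it measurable. *)
Lemma le_ge0_integral (d : measure_display) (T : measurableType d)
    (nu : {measure set T -> \bar R}) (f g : T -> \bar R) :
  (forall x, 0 <= f x) -> (forall x, f x <= g x) ->
  \int[nu]_x f x <= \int[nu]_x g x.
Proof.
move=> f0 fg; have g0 x : 0 <= g x by exact: le_trans (fg x).
rewrite !ge0_integralTE//; apply: ereal_sup_le => _ [h /= hf <-].
by exists h => // x; exact: le_trans (fg x).
Qed.

Lemma iter_int_ge0 (n : nat) (F : (nat -> R) -> \bar R) :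
  (forall x, 0 <= F x) -> 0 <= iter_int n F.
Proof.
elim: n F => [|n IH] F F0 //=.
by apply: integral_ge0 => t _; apply: IH.
Qed.

Lemma le_iter_int (n : nat) (F G : (nat -> R) -> \bar R) :
  (forall x, 0 <= F x) -> (forall x, F x <= G x) ->
  iter_int n F <= iter_int n G.
Proof.
elim: n F G => [|n IH] F G F0 FG //=.
apply: le_ge0_integral => t; first exact: iter_int_ge0.
exact: IH.
Qed.

Definition upd (n : nat) (t : R) (x : nat -> R) : nat -> R :=
  fun i => if i == n then t else x i.

(* Measurability for the coordinate maps, tested on arbitrary parameter spaces
   so that it is stable under freezing some of the coordinates. *)
Definition coord_measurable (F : (nat -> R) -> \bar R) : Prop :=
  forall (d : measure_display) (T : measurableType d) (z : T -> nat -> R),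
    (forall i, measurable_fun setT (fun t => z t i)) ->
    measurable_fun setT (fun t => F (z t)).

(** Joint version of the above: the parameter also varies measurably, so that a coordinate can later
    be moved into it. *)
Definition param_measurable (d : measure_display) (T : measurableType d)
    (F : T -> (nat -> R) -> \bar R) : Prop :=
  forall (d' : measure_display) (T' : measurableType d')
    (u : T' -> T) (z : T' -> nat -> R),
    measurable_fun setT u ->
    (forall i, measurable_fun setT (fun t => z t i)) ->
    measurable_fun setT (fun t => F (u t) (z t)).

Lemma measurable_upd (d : measure_display) (T : measurableType d)
    (z : T -> nat -> R) (s : T -> R) (n : nat) :
  measurable_fun setT s -> (forall i, measurable_fun setT (fun t => z t i)) ->
  forall i, measurable_fun setT (fun t => upd n (s t) (z t) i).
Proof. by move=> ms mz i; rewrite /upd; case: (i == n). Qed.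

Lemma coord_measurable_upd (F : (nat -> R) -> \bar R) (n : nat) (t : R) :
  coord_measurable F -> coord_measurable (fun x => F (upd n t x)).
Proof. by move=> mF d T z mz; apply: mF; exact: measurable_upd. Qed.

Lemma param_measurable_upd (F : (nat -> R) -> \bar R) (n : nat) :
  coord_measurable F ->
  @param_measurable _ (measurableTypeR R) (fun t x => F (upd n t x)).
Proof. by move=> mF d T u z mu mz; apply: mF; exact: measurable_upd. Qed.

(** Induction on [n] with the parameter space generalised: the outermost coordinate joins it as a
    factor of a product, and Tonelli gives measurability of the partial integral. *)
Lemma measurable_iter_int (n : nat) (d : measure_display) (T : measurableType d)
    (F : T -> (nat -> R) -> \bar R) :
  (forall t x, 0 <= F t x) -> param_measurable F ->
  measurable_fun setT (fun t => iter_int n (F t)).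
Proof.
elim: n d T F => [|n IH] d T F F0 mF /=.
  apply: (mF _ T idfun (fun _ _ => 0%R)) => [|i]; first exact: measurable_id.
  exact: measurable_cst.
pose G (ts : T * measurableTypeR R) (x : nat -> R) := F ts.1 (upd n ts.2 x).
have mG : measurable_fun setT (fun ts => iter_int n (G ts)).
  apply: IH => [ts x|d' T' u z mu' mz]; first exact: F0.
  apply: mF.
    by apply: (measurableT_comp _ mu'); exact: measurable_fst.
  apply: measurable_upd => //.
  by apply: (measurableT_comp _ mu'); exact: measurable_snd.
apply: (@measurable_fun_fubini_tonelli_F _ _ _ _ _ mu _ mG) => ts.
by apply: iter_int_ge0 => x; exact: F0.
Qed.

Lemma measurable_iter_int_upd (n : nat) (F : (nat -> R) -> \bar R) :
  (forall x, 0 <= F x) -> coord_measurable F ->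
  measurable_fun setT
    (fun t : measurableTypeR R => iter_int n (fun x => F (upd n t x))).
Proof.
move=> F0 mF; apply: (@measurable_iter_int n _ _ (fun t x => F (upd n t x))) => //.
exact: param_measurable_upd.
Qed.

Lemma iter_intD (n : nat) (F G : (nat -> R) -> \bar R) :
  (forall x, 0 <= F x) -> (forall x, 0 <= G x) ->
  coord_measurable F -> coord_measurable G ->
  iter_int n (fun x => F x + G x) = iter_int n F + iter_int n G.
Proof.
elim: n F G => [|n IH] F G F0 G0 mF mG //=.
rewrite -ge0_integralD//; first 1 last.
- by move=> t _; apply: iter_int_ge0.
- exact: measurable_iter_int_upd.
- by move=> t _; apply: iter_int_ge0.
- exact: measurable_iter_int_upd.
apply: eq_integral => t _.
by apply: (IH (fun x => F (upd n t x)) (fun x => G (upd n t x))) => //;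
  exact: coord_measurable_upd.
Qed.

Lemma iter_intZ (n : nat) (k : R) (F : (nat -> R) -> \bar R) :
  (0 <= k)%R -> (forall x, 0 <= F x) -> coord_measurable F ->
  iter_int n (fun x => k%:E * F x) = k%:E * iter_int n F.
Proof.
move=> k0; elim: n F => [|n IH] F F0 mF //=.
rewrite -ge0_integralZl//; first 1 last.
- exact: measurable_iter_int_upd.
- by move=> t _; apply: iter_int_ge0.
apply: eq_integral => t _.
by apply: (IH (fun x => F (upd n t x))) => //; exact: coord_measurable_upd.
Qed.

(** Lebesgue measure is [lam^-1] times its pushforward under division by [lam]: the two agree on
    half-open intervals, hence everywhere by uniqueness. The rest is change of variables. *)
Lemma integral_scale (lam : R) (f : R -> \bar R) :
  (0 < lam)%R -> (forall t, 0 <= f t) ->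
  measurable_fun setT (f : measurableTypeR R -> \bar R) ->
  \int[mu]_t ((lam^-1)%:E * f (t / lam)%R) = \int[mu]_t f t.
Proof.
move=> lam0 f0 mf.
pose phi (t : measurableTypeR R) : measurableTypeR R := (t / lam)%R.
have mphi : measurable_fun setT phi by exact: mulrr_measurable.
have lamV0 : (0 <= lam^-1)%R by rewrite invr_ge0 ltW.
pose k : {nonneg R} := NngNum lamV0.
have nuE A : measurable A -> mu A = mscale k (pushforward mu phi) A.
  move=> mA; apply/lebesgue_measure_unique => //= _ [[a b]] _ <-.
  rewrite /mscale /= /pushforward.
  have -> : phi @^-1` `]a, b] = `](a * lam)%R, (b * lam)%R]%classic.
    apply/seteqP; split=> t /=; rewrite !in_itv/= /phi.
      by rewrite ltr_pdivlMr// ler_pdivrMr.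
    by rewrite ltr_pdivlMr// ler_pdivrMr.
  rewrite !lebesgue_measure_itv/= !lte_fin ltr_pM2r//.
  case: ifP => _; last by rewrite mule0.
  by rewrite -!EFinB -EFinM -mulrBl mulrCA mulVf ?mulr1 ?gt_eqF.
rewrite [RHS](eq_measure_integral (mscale k (pushforward mu phi))); last first.
  by move=> A mA _; exact: nuE.
rewrite ge0_integral_mscale// ge0_integral_pushforward//.
rewrite preimage_setT ge0_integralZl//.
exact: measurableT_comp.
Qed.

(** Coordinate [0] is integrated innermost, so the induction peels the other coordinates off
    untouched and rescales only in the base case. *)
Lemma iter_int_scale0 (n : nat) (lam : R) (F : (nat -> R) -> \bar R) :
  (0 < lam)%R -> (forall x, 0 <= F x) -> coord_measurable F ->
  iter_int n.+1 (fun x => (lam^-1)%:E * F (upd 0 (x 0%N / lam)%R x)) =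
  iter_int n.+1 F.
Proof.
move=> lam0; elim: n F => [|n IH] F F0 mF.
  rewrite /= -(@integral_scale lam (fun t => F (upd 0 t (fun=> 0%R))))//.
    apply: eq_integral => t _; congr (_ * F _).
    by apply/funext => i; rewrite /upd; case: (i == 0%N).
  apply: mF; apply: (measurable_upd (T := measurableTypeR R)) => [|i].
    exact: measurable_id.
  exact: measurable_cst.
rewrite [LHS]/= [RHS]/=; apply: eq_integral => t _.
have /= <- := IH (fun x => F (upd n.+1 t x)) (fun _ => F0 _)
  (coord_measurable_upd n.+1 t mF).
congr (integral _ _ _); apply/funext => s.
congr (iter_int _ _); apply/funext => x; congr (_ * F _).
by apply/funext => i; rewrite /upd; case: i => [|i]//=.
Qed.

Lemma integral_abs_ball (c r : R) : (0 < r)%R ->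
  \int[mu]_t ((`|t - c| < r)%R%:R)%:E = (2 * r)%:E.
Proof.
move=> r0; under eq_integral => t _.
  rewrite (_ : ((`|t - c| < r)%R%:R)%R = \1_(ball c r) t); last first.
    rewrite indicE; congr (_ %:R)%R; congr nat_of_bool.
    by apply/idP/idP; rewrite inE /ball /= distrC.
  over.
rewrite integral_indic//; last exact: measurable_ball.
by rewrite setIT mulr_natl; exact: (lebesgue_measure_ball c (ltW r0)).
Qed.

Lemma coord_measurable_box (n : nat) (c r : nat -> R) :
  coord_measurable
    (fun x => (\prod_(i < n) (`|x i - c i| < r i)%R%:R)%R%:E).
Proof.
move=> d T z mz; apply/measurable_EFinP; apply: measurable_prod => i _.
apply: (measurableT_comp (f := fun b : bool => b%:R : R)) => //.
apply: measurable_fun_ltr => //.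
by apply: measurableT_comp => //; apply: measurable_funB.
Qed.

Lemma iter_int_box (n : nat) (c r : nat -> R) : (forall i, 0 < r i)%R ->
  iter_int n (fun x => (\prod_(i < n) (`|x i - c i| < r i)%R%:R)%R%:E) =
  (\prod_(i < n) (2 * r i))%R%:E.
Proof.
move=> r0; elim: n => [|n IH]; first by rewrite /= !big_ord0.
rewrite [RHS]/= big_ord_recr /= EFinM -IH -(integral_abs_ball (c n))//.
rewrite [in RHS]IH -ge0_integralZl ?lee_fin//; last 2 first.
  apply/measurable_EFinP.
  apply: (measurableT_comp (f := fun b : bool => b%:R : R)) => //.
  apply: measurable_fun_ltr => //.
  by apply: measurableT_comp => //; apply: measurable_funB.
  by apply: prodr_ge0 => i _; rewrite mulr_ge0// ltW.
apply: eq_integral => t _.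
rewrite muleC -IH -iter_intZ//; first 1 last.
- by move=> x; rewrite lee_fin; apply: prodr_ge0.
- exact: coord_measurable_box.
congr (iter_int _ _); apply/funext => x.
rewrite big_ord_recr /= eqxx EFinM muleC; congr (_ * _%:E).
by apply: eq_bigr => i _; rewrite ltn_eqF.
Qed.

(** Round every coordinate down to the grid of mesh [1 / (n + 1)]. The rounded map takes countably
    many values, with measurable level sets, and by continuity of [g] its image converges pointwise
    to the desired function. *)
Lemma measurable_continuous_row (k : nat) (g : 'rV[R]_k -> R)
    (d : measure_display) (T : measurableType d) (z : T -> nat -> R) :
  continuous g -> (forall i, measurable_fun setT (fun t => z t i)) ->
  measurable_fun setT (fun t => g (\row_(i < k) z t i)).
Proof.
move=> cg mz.
pose e (n : nat) : R := n.+1%:R.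
have e0 n : (0 < e n)%R by rewrite ltr0n.
pose G n (c : {ffun 'I_k -> int}) := g (\row_(i < k) ((c i)%:~R / e n))%R.
pose phi n (t : T) : {ffun 'I_k -> int} := [ffun i : 'I_k => Num.floor (e n * z t i)%R].
apply: (@measurable_fun_cvg _ _ _ _ (fun n t => G n (phi n t))).
  move=> n _ B mB; rewrite setTI.
  have -> : (fun t => G n (phi n t)) @^-1` B =
      \bigcup_(c in [set: {ffun 'I_k -> int}]) ([set t | phi n t = c] `&` [set _ | B (G n c)]).
    apply/seteqP; split => [t Bt|t [c _ [<-]]//].
    by exists (phi n t).
  apply: countable_bigcupT_measurable => [|c]; first exact: countableP.
  have [Bc|Bc] := pselect (B (G n c)); last first.
    rewrite (_ : [set t | _] `&` _ = set0)//.
    by apply/seteqP; split => // t [_ /Bc].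
  rewrite (_ : [set t | _] `&` _ = [set t | phi n t = c]); last first.
    by apply/seteqP; split => [t []|].
  have -> : [set t | phi n t = c] =
      \bigcap_(i in [set: 'I_k]) ((fun t => e n * z t i)%R @^-1`
         `[(c i)%:~R, (c i + 1)%:~R[%classic).
    apply/seteqP; split => [t <- i _|t ct] /=.
      by rewrite in_itv /= ffunE; exact: floor_itv.
    apply/ffunP => i; rewrite ffunE.
    apply/floor_def; have := ct i Logic.I.
    by rewrite /= in_itv.
  apply: fin_bigcap_measurable => // i _.
  rewrite -[X in measurable X]setTI.
  apply: (measurable_funM (measurable_cst _) (mz i)) => //.
move=> t _.
apply: (cvg_comp _ g); last exact: cg.
apply/cvg_ballP => eps eps0.
near=> n; split=> // i j; rewrite !mxE ffunE /ball /=.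
have /andP[f1 f2] := floor_itv (e n * z t j)%R.
have en : ((e n)^-1 < eps)%R by near: n; exact: near_infty_natSinv_lt (PosNum eps0).
apply: le_lt_trans en.
have -> : (z t j - (Num.floor (e n * z t j))%:~R / e n =
  (e n * z t j - (Num.floor (e n * z t j))%:~R) / e n)%R.
  by rewrite mulrBl mulrAC mulfV ?mul1r ?gt_eqF.
rewrite normrM normfV (gtr0_norm (e0 n)) ler_pdivrMr// mulVf ?gt_eqF//.
rewrite ger0_norm ?subr_ge0// lerBlDl ltW//.
by rewrite intrD in f2.
Unshelve. all: by end_near.
Qed.

End IteratedIntegral.

(** * Metropolis--Hastings gap and indicator test functions *)

Section MetropolisHastings.
Context {R : realType} (k : nat).
Implicit Types (g h : 'rV[R]_k -> R) (x y : 'rV[R]_k).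

Definition row_measurable (g : 'rV[R]_k -> R) : Prop :=
  coord_measurable (fun x : nat -> R => (g (\row_(i < k) x (val i)))%:E).

Lemma continuous_row_measurable g : continuous g -> row_measurable g.
Proof.
move=> cg d T z mz; apply/measurable_EFinP.
exact: (measurable_continuous_row cg mz).
Qed.

Lemma row_measurableM g h :
  row_measurable g -> row_measurable h -> row_measurable (fun x => g x * h x).
Proof.
move=> mg mh d T z mz; apply/measurable_EFinP/measurable_funM.
  exact/measurable_EFinP/mg.
exact/measurable_EFinP/mh.
Qed.

Lemma row_measurable_ltr g h :
  row_measurable g -> row_measurable h ->
  row_measurable (fun x => (g x < h x)%R%:R).
Proof.
move=> mg mh d T z mz; apply/measurable_EFinP.
apply: (measurableT_comp (f := fun b : bool => b%:R : R)) => //.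
apply: measurable_fun_ltr.
  exact/measurable_EFinP/mg.
exact/measurable_EFinP/mh.
Qed.

Lemma row_measurable_negb (J : 'rV[R]_k -> bool) :
  row_measurable (fun x => (J x)%:R) -> row_measurable (fun x => (~~ J x)%:R).
Proof.
move=> mJ d T z mz; apply/measurable_EFinP.
rewrite (_ : (fun t => _) =
  (fun t => 1 - (J (\row_(i < k) z t (val i)))%:R)); last first.
  by apply/funext => t; case: (J _); rewrite ?subrr ?subr0.
apply: measurable_funB => //; exact/measurable_EFinP/mJ.
Qed.

Lemma intRd_le (g h : 'rV[R]_k -> \bar R) :
  (forall x, 0 <= g x)%E -> (forall x, g x <= h x)%E -> (intRd g <= intRd h)%E.
Proof. by move=> g0 gh; exact: le_iter_int. Qed.

Lemma intRdD g h : (forall x, 0 <= g x) -> (forall x, 0 <= h x) ->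
  row_measurable g -> row_measurable h ->
  intRd (fun x => (g x + h x)%:E) =
  (intRd (fun x => (g x)%:E) + intRd (fun x => (h x)%:E))%E.
Proof.
move=> g0 h0 mg mh; rewrite /intRd -iter_intD//.
- by move=> x; rewrite lee_fin.
- by move=> x; rewrite lee_fin.
Qed.

Lemma intRdZ (a : R) g : 0 <= a -> (forall x, 0 <= g x) -> row_measurable g ->
  intRd (fun x => (a * g x)%:E) = (a%:E * intRd (fun x => (g x)%:E))%E.
Proof.
move=> a0 g0 mg; rewrite /intRd -iter_intZ//.
by move=> x; rewrite lee_fin.
Qed.

Lemma row_measurableZ (a : R) g :
  row_measurable g -> row_measurable (fun x => a * g x).
Proof.
move=> mg; apply: row_measurableM => // d T z mz.
Qed.

Lemma row_measurableD g h :
  row_measurable g -> row_measurable h -> row_measurable (fun x => g x + h x).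
Proof.
move=> mg mh d T z mz; apply/measurable_EFinP/measurable_funD.
  exact/measurable_EFinP/mg.
exact/measurable_EFinP/mh.
Qed.

Lemma intRd_comb (a b u v : R) g h : 0 <= a -> 0 <= b ->
  (forall x, 0 <= g x) -> (forall x, 0 <= h x) ->
  row_measurable g -> row_measurable h ->
  intRd (fun x => (g x)%:E) = u%:E -> intRd (fun x => (h x)%:E) = v%:E ->
  intRd (fun x => (a * g x + b * h x)%:E) = (a * u + b * v)%:E.
Proof.
move=> a0 b0 g0 h0 mg mh gu hv.
rewrite intRdD; [|by move=> x; rewrite mulr_ge0|by move=> x; rewrite mulr_ge0
  |exact: row_measurableZ|exact: row_measurableZ].
by rewrite !intRdZ// gu hv EFinD !EFinM.
Qed.

Lemma mh_acc_ge0 p q x y : (forall x, 0 < p x) -> (forall x y, 0 < q x y) ->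
  0 <= mh_acc p q x y.
Proof.
by move=> p0 q0; rewrite le_min ler01 divr_ge0// mulr_ge0// ltW.
Qed.

Lemma mh_rate_le_proposal p q x y : (forall x y, 0 < q x y) ->
  mh_acc p q x y * q x y <= q x y.
Proof.
move=> q0; rewrite -[leRHS]mul1r ler_pM2r//.
by rewrite ge_min lexx.
Qed.

(** The second argument of the minimum, with [q x y] cancelled. With the previous bound, the flow
    from [x] to [y] is at most either directed proposal flow. *)
Lemma mh_rate_le_reverse p q x y :
  (forall x, 0 < p x) -> (forall x y, 0 < q x y) ->
  mh_acc p q x y * q x y <= p y * q y x / p x.
Proof.
move=> p0 q0; rewrite -ler_pdivlMr// ge_min; apply/orP; right.
by rewrite invfM mulrA.
Qed.

(* The test function is the centred and normalised indicator of [J]. *)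
Lemma mh_gap_le_indicator (p : 'rV[R]_k -> R) (q : 'rV[R]_k -> 'rV[R]_k -> R)
    (J F N : 'rV[R]_k -> bool) (K eps m a tau V : R) :
  (forall x, 0 < p x) -> (forall x y, 0 < q x y) ->
  (forall x y, q x y <= K) -> 0 <= eps -> 0 < m < 1 ->
  row_measurable p -> row_measurable (fun x => (J x)%:R) ->
  row_measurable (fun x => (F x)%:R) -> row_measurable (fun x => (N x)%:R) ->
  open [set x | J x] ->
  (forall x y, J x -> ~~ F y -> q x y <= K * eps) ->
  (forall y, ~~ F y -> N y) ->
  intRd (fun x => (p x)%:E) = 1%E ->
  intRd (fun x => (p x * (J x)%:R)%:E) = m%:E ->
  intRd (fun x => ((J x)%:R)%:E) = a%:E ->
  intRd (fun x => (p x * (F x)%:R)%:E) = tau%:E ->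
  intRd (fun x => ((N x)%:R)%:E) = V%:E ->
  (Gap p q <= (K * (a * tau + eps * V) / (m * (1 - m)))%:E)%E.
Proof.
move=> p0 q0 qK eps0 /andP[m0 m1] mp mJ mF mN oJ JFq FN Ip IpJ IJ IpF IN.
have pge0 x : 0 <= p x by exact: ltW.
have K0 : 0 <= K by apply: le_trans (qK 0 0); exact: ltW.
have m1' : 0 < 1 - m by rewrite subr_gt0.
have mm0 : 0 < m * (1 - m) by rewrite mulr_gt0.
have V0 : 0 <= V by rewrite -lee_fin -IN; apply: iter_int_ge0 => x; rewrite lee_fin.
have a0 : 0 <= a by rewrite -lee_fin -IJ; apply: iter_int_ge0 => x; rewrite lee_fin.
have tau0 : 0 <= tau.
  by rewrite -lee_fin -IpF; apply: iter_int_ge0 => x; rewrite lee_fin mulr_ge0.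
(* Standard deviation of the indicator of [J], a Bernoulli variable of mean [m]. *)
pose s := Num.sqrt (m * (1 - m)).
have s0 : 0 < s by rewrite sqrtr_gt0.
have ss : s ^+ 2 = m * (1 - m) by rewrite sqr_sqrtr// ltW.
pose f x := ((J x)%:R - m) / s.
have pJ0 x : 0 <= p x * (J x)%:R by rewrite mulr_ge0.
have pNJ0 x : 0 <= p x * (~~ J x)%:R by rewrite mulr_ge0.
have pF0 x : 0 <= p x * (F x)%:R by rewrite mulr_ge0.
have mpJ := row_measurableM mp mJ.
have mpNJ := row_measurableM mp (row_measurable_negb mJ).
have mpF := row_measurableM mp mF.
have IpJ' : intRd (fun x => (p x * (~~ J x)%:R)%:E) = (1 - m)%:E.
  have : intRd (fun x => (p x * (J x)%:R + p x * (~~ J x)%:R)%:E) = 1%E.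
    rewrite -Ip; congr (intRd _); apply/funext => x.
    by case: (J x); rewrite /= mulr1 mulr0 ?addr0 ?add0r.
  rewrite intRdD// IpJ; case: intRd => [r [] mr| |]//.
  by congr (_%:E); rewrite -mr addrAC subrr add0r.
have fL2 : L2_01 p f.
  split.
  (* [f] takes two values, so each preimage is assembled from [J] and its complement, which are
     Borel because [J] is open. *)
  - move=> B mB.
    have -> : f @^-1` B =
       ([set x | J x] `&` [set _ | B ((1 - m) / s)]) `|`
       (~` [set x | J x] `&` [set _ | B ((0 - m) / s)]).
      apply/seteqP; split=> x /=; rewrite /f.
        by case: (J x) => ?; [left|right].
      by case=> -[]; case: (J x).
    have mJJ : (@open 'rV[R]_k).-sigma.-measurable [set x | J x].
      exact: sub_sigma_algebra.
    apply: measurableU; apply: measurableI => //.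
    + have [Bc|Bc] := pselect (B ((1 - m) / s)).
        by rewrite (_ : [set _ | _] = setT)//; apply/seteqP; split.
      by rewrite (_ : [set _ | _] = set0)//; apply/seteqP; split.
    + exact: measurableC.
    + have [Bc|Bc] := pselect (B ((0 - m) / s)).
        by rewrite (_ : [set _ | _] = setT)//; apply/seteqP; split.
      by rewrite (_ : [set _ | _] = set0)//; apply/seteqP; split.
  - rewrite (_ : (fun x => _) =
        (fun x => ((1 - m) / s * (p x * (J x)%:R))%:E)); last first.
      apply/funext => x; congr (_%:E); rewrite /f; case: (J x) => /=.
        by rewrite max_l ?divr_ge0 ?ltW// mulr1.
      by rewrite max_r ?mulr0 ?mul0r// sub0r mulNr oppr_le0 divr_ge0 ?ltW.
    rewrite (_ : (fun x => (Num.max _ _ * _)%:E) =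
        (fun x => (m / s * (p x * (~~ J x)%:R))%:E)); last first.
      apply/funext => x; congr (_%:E); rewrite /f; case: (J x) => /=.
        by rewrite max_r ?mulr0 ?mul0r// oppr_le0 divr_ge0 ?ltW.
      by rewrite sub0r mulNr opprK max_l ?divr_ge0 ?ltW// mulr1.
    rewrite !intRdZ ?divr_ge0 ?(ltW m0) ?(ltW m1') ?(ltW s0)//.
    by rewrite IpJ IpJ' -!EFinM; congr (_%:E); rewrite mulrAC [RHS]mulrAC (mulrC m).
  - rewrite (_ : (fun x => _) =
        (fun x => ((1 - m) ^+ 2 / s ^+ 2 * (p x * (J x)%:R) +
                    m ^+ 2 / s ^+ 2 * (p x * (~~ J x)%:R))%:E)); last first.
      apply/funext => x; congr (_%:E); rewrite /f expr_div_n; case: (J x) => /=.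
        by rewrite mulr0 mulr0 addr0 mulr1.
      by rewrite mulr0 mulr0 !add0r mulr1 sqrrN.
    rewrite (intRd_comb _ _ pJ0 pNJ0 mpJ mpNJ IpJ IpJ') ?divr_ge0 ?sqr_ge0//.
    by rewrite ss; congr (_%:E); field; rewrite !gt_eqF.
apply: (@le_trans _ _ (dirichlet p q f)); first by apply: ereal_inf_lbound; exists f.
pose w := (m * (1 - m))^-1.
have w0 : 0 <= w by rewrite invr_ge0 ltW.
have fE x y : (f y - f x) ^+ 2 = w * (J x != J y)%:R.
  rewrite /f -mulrBl expr_div_n ss -/w mulrC; congr (_ * _).
  by case: (J x); case: (J y) => /=; rewrite ?eqxx /=; lra.
have Kw0 : 0 <= K * w by rewrite mulr_ge0.
(* The majorant adds the bound for [x] in [J] (first two terms) to the one for [x] outside [J] (last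
   two), so that one expression serves all [x]. *)
have inner x : ((p x)%:E * mh_kernel_int p q x (fun y => ((f y - f x) ^+ 2)%:E) <=
  (K * w * (tau * (J x)%:R + eps * V * p x + (a * (p x * (F x)%:R)
     + eps * m * (N x)%:R)))%:E)%E.
  (* The atom at [x] carries a zero increment, so the rejection part vanishes. *)
  rewrite /mh_kernel_int subrr expr0n /= mule0 adde0.
  have xV0 : 0 <= (p x)^-1 by rewrite invr_ge0.
  have acc_ge0 y : (0 <= (mh_acc p q x y * q x y)%:E * ((f y - f x) ^+ 2)%:E)%E.
    by rewrite -EFinM lee_fin mulr_ge0 ?sqr_ge0// mulr_ge0 ?mh_acc_ge0// ltW.
  have [Jx|NJx] := boolP (J x).
    have : (intRd (fun y => (mh_acc p q x y * q x y)%:E * ((f y - f x) ^+ 2)%:E) <=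
        (K * w / p x * tau + K * w * eps * V)%:E)%E.
      rewrite -(@intRd_comb (K * w / p x) (K * w * eps) tau V
        (fun y => p y * (F y)%:R) (fun y => (N y)%:R))//; first 1 last.
      + by rewrite mulr_ge0.
      + by rewrite mulr_ge0.
      apply: intRd_le => // y; rewrite -EFinM lee_fin fE Jx.
      have -> : K * w / p x * (p y * (F y)%:R) + K * w * eps * (N y)%:R =
        (K * p y / p x * (F y)%:R + K * eps * (N y)%:R) * w by ring.
      rewrite mulrCA [leLHS]mulrC ler_wpM2r//.
      have [Jy|NJy] := boolP (J y).
        by rewrite mulr0 addr_ge0// !mulr_ge0.
      (* Far [y]: use the reverse flow, whose factor [p y] integrates to [tau] over [F]. Near [y]:
         the forward proposal is already at most [K * eps], and [y] lies in [N]. *)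
      rewrite mulr1; have [Fy|NFy] := boolP (F y).
        rewrite mulr1; apply: (le_trans (mh_rate_le_reverse x y p0 q0)).
        apply: (@le_trans _ _ (K * p y / p x)); last by rewrite lerDl !mulr_ge0.
        by rewrite ler_wpM2r// mulrC ler_wpM2r.
      rewrite FN// mulr0 add0r mulr1.
      exact: le_trans (mh_rate_le_proposal p x y q0) (JFq _ _ Jx NFy).
    move=> H; apply: le_trans (lee_wpmul2l _ H) _; first by rewrite lee_fin.
    rewrite -EFinM lee_fin mulr1 -subr_ge0.
    rewrite (_ : _ - _ = K * w * (a * (p x * (F x)%:R) + eps * m * (N x)%:R)); last first.
      by field; rewrite gt_eqF.
    by rewrite !(mulr_ge0, addr_ge0)// ltW.
  have : (intRd (fun y => (mh_acc p q x y * q x y)%:E * ((f y - f x) ^+ 2)%:E) <=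
      (K * w * (F x)%:R * a + K * w * eps * (N x)%:R / p x * m)%:E)%E.
    rewrite -(@intRd_comb (K * w * (F x)%:R) (K * w * eps * (N x)%:R / p x) a m
      (fun y => (J y)%:R) (fun y => p y * (J y)%:R))//; first 1 last.
    + by rewrite mulr_ge0.
    + by rewrite !mulr_ge0.
    apply: intRd_le => // y; rewrite -EFinM lee_fin fE (negbTE NJx).
    have -> : K * w * (F x)%:R * (J y)%:R + K * w * eps * (N x)%:R / p x * (p y * (J y)%:R) =
        (K * (F x)%:R * (J y)%:R + p y * (K * eps) / p x * (N x)%:R * (J y)%:R) * w by ring.
    rewrite mulrCA [leLHS]mulrC ler_wpM2r//.
    have [Jy|NJy] := boolP (J y); last first.
      by rewrite mulr0 addr_ge0// !mulr_ge0.
    (* The roles are swapped: for far [x] the forward proposal is bounded by [K] on [J], of volume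
       [a]; otherwise the reverse proposal starts in [J] and is at most [K * eps]. *)
    rewrite !mulr1; have [Fx|NFx] := boolP (F x).
      rewrite mulr1; apply: (le_trans (mh_rate_le_proposal p x y q0)).
      by apply: (le_trans (qK x y)); rewrite lerDl !mulr_ge0.
    rewrite FN// mulr0 add0r mulr1.
    apply: le_trans (mh_rate_le_reverse x y p0 q0) _.
    by rewrite ler_wpM2r// ler_wpM2l// JFq.
  move=> H; apply: le_trans (lee_wpmul2l _ H) _; first by rewrite lee_fin.
  rewrite -EFinM lee_fin mulr0 add0r -subr_ge0.
  rewrite (_ : _ - _ = K * w * (eps * V * p x)); last first.
    by field; rewrite gt_eqF.
  by rewrite !mulr_ge0.
rewrite /dirichlet.
have total : (intRd (fun x => (p x)%:E * mh_kernel_int p q x (fun y => ((f y - f x) ^+ 2)%:E)) <=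
   (K * w * (tau * a + eps * V * 1 + (a * tau + eps * m * V)))%:E)%E.
  have g10 x : 0 <= tau * (J x)%:R + eps * V * p x.
    by rewrite addr_ge0// !mulr_ge0.
  have g20 x : 0 <= a * (p x * (F x)%:R) + eps * m * (N x)%:R.
    by rewrite addr_ge0// !mulr_ge0// ltW.
  have mg1 : row_measurable (fun x => tau * (J x)%:R + eps * V * p x).
    by apply: row_measurableD; apply: row_measurableZ.
  have mg2 : row_measurable (fun x => a * (p x * (F x)%:R) + eps * m * (N x)%:R).
    by apply: row_measurableD; apply: row_measurableZ => //; apply: row_measurableM.
  apply: (@le_trans _ _ _ _ _ (intRd_le _ inner)) => [x|].
    rewrite mule_ge0 ?lee_fin// /mh_kernel_int subrr expr0n /= mule0 adde0.
    apply: iter_int_ge0 => y; rewrite -EFinM lee_fin mulr_ge0 ?sqr_ge0//.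
    by rewrite mulr_ge0 ?mh_acc_ge0// ltW.
  rewrite intRdZ//; first 1 last.
  - by move=> x; rewrite addr_ge0.
  - exact: row_measurableD.
  rewrite intRdD// (@intRd_comb _ _ a 1)// ?mulr_ge0//.
  rewrite (@intRd_comb _ _ tau V)// ?mulr_ge0 ?(ltW m0)//.
apply: le_trans (lee_wpmul2l _ total) _; first by rewrite lee_fin invr_ge0.
rewrite -EFinM lee_fin -/w -subr_ge0.
(* The factor one half of the Dirichlet form absorbs the doubled [a * tau]; the slack left comes
   from [1 + m <= 2]. *)
rewrite (_ : _ - _ = 2^-1 * (K * w * (eps * V * (1 - m)))); last by field.
by rewrite !mulr_ge0// ltW.
Qed.
End MetropolisHastings.

(** * Rescaling the first coordinate *)

Section Scaling.
Context {R : realType}.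

(** The map undoing the contraction; [scaled_density lam p x] unfolds to
    [lam^-1 * p (scale_row lam x)]. *)
Definition scale_row (k : nat) (lam : R) (x : 'rV[R]_k) : 'rV[R]_k :=
  \row_(i < k) (if val i == 0%N then x ord0 i / lam else x ord0 i).

Lemma scale_row_upd (k : nat) (lam : R) (x : nat -> R) :
  scale_row lam (\row_(i < k) x (val i)) =
  \row_(i < k) upd 0 (x 0%N / lam) x (val i).
Proof.
apply/rowP => i; rewrite !mxE /upd; case: ifP => //= /eqP i0.
by rewrite i0.
Qed.

Lemma row_measurable_scale (k : nat) (lam : R) (g : 'rV[R]_k -> R) :
  row_measurable g -> row_measurable (fun x => g (scale_row lam x)).
Proof.
move=> mg d T z mz.
rewrite (_ : (fun t => _) =
  (fun t => (g (\row_(i < k) upd 0 (z t 0%N / lam) (z t) (val i)))%:E)).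
  apply: (mg _ _ (fun t => upd 0 (z t 0%N / lam) (z t))).
  by apply: measurable_upd => //; exact: measurable_funM.
by apply/funext => t; rewrite scale_row_upd.
Qed.

Lemma intRd_scale (k : nat) (lam : R) (g : 'rV[R]_k -> R) :
  (0 < k)%N -> 0 < lam -> (forall x, 0 <= g x) -> row_measurable g ->
  intRd (fun x => (lam^-1 * g (scale_row lam x))%:E) =
  intRd (fun x => (g x)%:E).
Proof.
case: k g => // k g _ lam0 g0 mg; rewrite /intRd -(iter_int_scale0 _ lam0 _ mg).
  congr (iter_int _ _); apply/funext => x.
  by rewrite scale_row_upd EFinM.
by move=> x; rewrite lee_fin.
Qed.

(** Centre and radii are indexed by all naturals, as the coordinates in [iter_int] are, so that
    induction on the dimension needs no reindexing. *)
Definition box (k : nat) (c r : nat -> R) (x : 'rV[R]_k) : bool :=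
  [forall i : 'I_k, `|x ord0 i - c (val i)| < r (val i)].

Lemma boxE (k : nat) (c r : nat -> R) (x : nat -> R) :
  (box c r (\row_(i < k) x (val i)))%:R =
  \prod_(i < k) (`|x (val i) - c (val i)| < r (val i))%R%:R :> R.
Proof.
have [/forallP b|] := boolP (box _ _ _).
  by rewrite big1// => i _; have := b i; rewrite mxE => ->.
rewrite negb_forall => /existsP[i]; rewrite mxE => /negbTE bi.
by rewrite (bigD1 i)//= bi mul0r.
Qed.

Lemma row_measurable_box (k : nat) (c r : nat -> R) :
  row_measurable (fun x : 'rV[R]_k => (box c r x)%:R).
Proof.
move=> d T z mz; under eq_fun do rewrite boxE.
exact: coord_measurable_box.
Qed.

Lemma intRd_box (k : nat) (c r : nat -> R) : (forall i, 0 < r i) ->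
  intRd (fun x : 'rV[R]_k => ((box c r x)%:R)%:E) =
  (\prod_(i < k) (2 * r (val i)))%:E.
Proof.
move=> r0; rewrite -(iter_int_box k c)//; congr (iter_int _ _).
by apply/funext => x; rewrite boxE.
Qed.

Lemma open_scaled_box (k : nat) (lam : R) (c r : nat -> R) :
  open [set x : 'rV[R]_k | box c r (scale_row lam x)].
Proof.
rewrite openE => x /= /forallP bx.
suff H : \forall y \near x, forall i : 'I_k,
    `|scale_row lam y ord0 i - c (val i)| < r (val i).
  by apply: filterS H => y yb; apply/forallP.
apply: (@filter_forall _ _ (fun (i : 'I_k) (y : 'rV[R]_k) =>
  `|scale_row lam y ord0 i - c (val i)| < r (val i)) (nbhs x)) => i.
have ci : scale_row lam y ord0 i @[y --> x] --> scale_row lam x ord0 i.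
  have cx := @coord_continuous R 1 k ord0 i x.
  under eq_fun do rewrite mxE.
  rewrite mxE; case: ifP => _; last exact: cx.
  exact: (cvgM cx (cvg_cst lam^-1)).
exact: (cvg_norm (cvgB ci (cvg_cst (c (val i)))) (lt_nbhsl (bx i))).
Qed.

Lemma scale_rowD (k : nat) (hk : (0 < k)%N) (lam h : R) (x : 'rV[R]_k) :
  scale_row lam (h *: ei R (Ordinal hk) + x) =
  h *: (lam^-1 *: e1 R k) + scale_row lam x.
Proof.
apply/rowP => i; rewrite !mxE.
rewrite -val_eqE /=; case: (val i == 0%N) => /=.
  by rewrite mulrDl mulr1 mulr1.
by rewrite !mulr0.
Qed.

(** The constant [ln lam^-1] cancels in the difference quotient, and the increment becomes one along
    [lam^-1 *: e1]; linearity of the differential extracts the factor [lam^-1] that makes the drift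
    blow up. *)
Lemma grad_log_scaled_density (k : nat) (hk : (0 < k)%N) (lam : R)
    (p : 'rV[R]_k -> R) (x : 'rV[R]_k) :
  0 < lam -> (forall x, 0 < p x) ->
  differentiable (fun z => ln (p z)) (scale_row lam x) ->
  grad (fun z => ln (scaled_density lam p z)) x ord0 (Ordinal hk) =
  lam^-1 * 'D_(e1 R k) (fun z => ln (p z)) (scale_row lam x).
Proof.
move=> lam0 p0 dp; rewrite mxE.
have lnE z : ln (scaled_density lam p z) = ln lam^-1 + ln (p (scale_row lam z)).
  by rewrite lnM ?posrE ?invr_gt0.
transitivity ('D_(lam^-1 *: e1 R k) (fun z => ln (p z)) (scale_row lam x)).
  rewrite /derive; set u := (X in lim (X @ _) = _); set v := (X in _ = lim (X @ _)).
  suff -> : u = v by [].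
  apply/funext => h; rewrite /u /v /=.
  by rewrite !lnE scale_rowD opprD addrACA subrr add0r.
by rewrite !deriveE// linearZ.
Qed.

(** * Euclidean norm and bounds on Gaussian densities *)

Lemma ler_norm_norm2 (k : nat) (x : 'rV[R]_k) (i : 'I_k) :
  `|x ord0 i| <= norm2 x.
Proof.
rewrite -sqrtr_sqr ler_sqrt ?sumr_ge0// => [|j _]; last exact: sqr_ge0.
by rewrite (bigD1 i)//= lerDl sumr_ge0// => j _; exact: sqr_ge0.
Qed.

Lemma row_measurable_norm2 (k : nat) : row_measurable (@norm2 R k).
Proof.
move=> d T z mz; apply/measurable_EFinP.
apply: (measurableT_comp (continuous_measurable_fun (@sqrt_continuous R))).
apply: measurable_sum => i.
under eq_fun do rewrite mxE.
exact: measurable_funX.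
Qed.

Definition gauss_max (k : nat) (s : R) : R := powR (2 * pi * s ^+ 2) (- (k%:R / 2)).

Lemma gauss_max_gt0 (k : nat) (s : R) : 0 < s -> 0 < gauss_max k s.
Proof. by move=> s0; rewrite powR_gt0// !mulr_gt0// ?exprn_gt0// pi_gt0. Qed.

Lemma gauss_density_gt0 (k : nat) (s : R) (m y : 'rV[R]_k) :
  0 < s -> 0 < gauss_density s m y.
Proof. by move=> s0; rewrite mulr_gt0 ?expR_gt0//; exact: gauss_max_gt0. Qed.

Lemma gauss_density_le_coord (k : nat) (s t : R) (m y : 'rV[R]_k) (i : 'I_k) :
  0 < s -> 0 <= t <= `|y ord0 i - m ord0 i| ->
  gauss_density s m y <= gauss_max k s * expR (- t ^+ 2 / (2 * s ^+ 2)).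
Proof.
move=> s0 /andP[t0 tym]; rewrite ler_pM2l; last exact: gauss_max_gt0.
rewrite ler_expR ler_pM2r ?invr_gt0 ?mulr_gt0 ?exprn_gt0// lerN2.
rewrite ler_pXn2r ?nnegrE//; last exact: sqrtr_ge0.
apply: le_trans tym _; have := ler_norm_norm2 (y - m) i.
by rewrite !mxE.
Qed.

Lemma gauss_density_le_max (k : nat) (s : R) (m y : 'rV[R]_k) :
  0 < s -> gauss_density s m y <= gauss_max k s.
Proof.
move=> s0; rewrite -[leRHS]mulr1 ler_pM2l; last exact: gauss_max_gt0.
rewrite -expR0 ler_expR mulNr oppr_le0 divr_ge0 ?sqr_ge0//.
by rewrite mulr_ge0// sqr_ge0.
Qed.

End Scaling.

(** * The MALA kernel *)

Lemma powR_opp_le (R : realType) (lam a b : R) :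
  0 < lam < 1 -> a <= b -> powR lam (- a) <= powR lam^-1 b.
Proof.
move=> /andP[l0 l1] ab.
have -> : powR lam (- a) = powR lam^-1 a.
  by rewrite -(powR_inv1 (ltW l0)) -powRrM mulN1r.
by apply: ler_powR => //; rewrite invf_ge1// ltW.
Qed.

(** Since [4 * u <= expR (4 * u)], the volume costs at most [4 * k * u] in the exponent; the total
    exponent is then at most [- (kappa * u - 4 * k - 1) * u], which is nonpositive. *)
Lemma gauss_beats_volume (R : realType) (kappa u : R) (k : nat) :
  0 <= u -> 4 * k%:R + 1 <= kappa * u ->
  expR (- (kappa * u ^+ 2)) * (4 * u) ^+ k * expR u <= 1.
Proof.
move=> u0 ku.
have h : (4 * u) ^+ k <= expR (k%:R * (4 * u)).
  rewrite expRM_natl lerXn2r ?nnegrE ?mulr_ge0 ?expR_ge0//.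
  by apply: le_trans (expR_ge1Dx _); rewrite lerDr.
apply: (@le_trans _ _ (expR (- (kappa * u ^+ 2)) * expR (k%:R * (4 * u)) * expR u)).
  by rewrite ler_pM2r ?expR_gt0// ler_pM2l ?expR_gt0.
rewrite -!expRD -[leRHS]expR0 ler_expR.
have := ler_wpM2r u0 ku; rewrite -subr_ge0 => hh.
rewrite (_ : _ + _ = - (kappa * u * u - (4 * k%:R + 1) * u)) ?oppr_le0//.
by rewrite expr2; ring.
Qed.

Lemma positive_log_continuous (R : realType) (k : nat) (p : 'rV[R]_k -> R) :
  (forall x, 0 < p x) -> (forall x, differentiable (fun z => ln (p z)) x) ->
  continuous p.
Proof.
move=> p0 dp x.
have -> : p = expR \o (fun z => ln (p z)).
  by apply/funext => z /=; rewrite lnK// posrE.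
apply: continuous_comp; last exact: continuous_expR.
exact: differentiable_continuous.
Qed.

Lemma exists_small_box (R : realType) (k : nat) (hk : (0 < k)%N)
    (p g : 'rV[R]_k -> R) (c : nat -> R) :
  (forall x, 0 < p x) -> continuous p -> continuous g ->
  g (\row_(i < k) c (val i)) != 0 ->
  exists r m b : R, [/\ 0 < r <= 2^-1, 0 < m <= 2^-1, 0 < b,
    intRd (fun x : 'rV[R]_k => (p x * (box c (fun=> r) x)%:R)%:E) = m%:E &
    forall x : 'rV[R]_k, box c (fun=> r) x -> b <= `|g x|].
Proof.
move=> p0 cp cg; set x0 := \row_(i < k) c (val i) => gx0.
pose b := `|g x0| / 2.
have b0 : 0 < b by rewrite divr_gt0// normr_gt0.
have /nbhs_ballP[e /= e0 he] : \forall x \near x0,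
    [/\ p x0 / 2 < p x, p x < 2 * p x0 & b < `|g x|].
  have px0 := p0 x0.
  have H1 : \forall x \near x0, p x0 / 2 < p x.
    have h : p x0 / 2 < p x0 by lra.
    exact: (cp x0 _ (lt_nbhsr h)).
  have H2 : \forall x \near x0, p x < 2 * p x0.
    have h : p x0 < 2 * p x0 by lra.
    exact: (cp x0 _ (lt_nbhsl h)).
  have H3 : \forall x \near x0, b < `|g x|.
    have h : b < `|g x0| by rewrite /b ltr_pdivrMr// ltr_pMr ?normr_gt0// ltr1n.
    exact: (cvg_norm (cg x0) (lt_nbhsr h)).
  by near=> x; split; near: x.
(* [e] keeps the box in the neighbourhood, [2^-1] gives [(2 * r) ^+ k <= 2 * r] as [k] is positive,
   and [(8 * p x0)^-1] then caps the mass at one half. *)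
pose r := Num.min e (Num.min 2^-1 (8 * p x0)^-1).
have r0 : 0 < r by rewrite !lt_min e0 !invr_gt0 mulr_gt0// ltr0n.
have r2 : r <= 2^-1 by rewrite !ge_min lexx orbT.
have r8 : r <= (8 * p x0)^-1 by rewrite !ge_min lexx !orbT.
have hbox (x : 'rV[R]_k) : box c (fun=> r) x ->
    [/\ p x0 / 2 < p x, p x < 2 * p x0 & b < `|g x|].
  move=> /forallP bx; apply: he; split => // i j.
  rewrite (ord1 i) mxE /ball /= distrC; apply: lt_le_trans (bx j) _.
  by rewrite ge_min lexx.
have mbox := @row_measurable_box R k c (fun=> r).
have Ibox : intRd (fun x : 'rV[R]_k => ((box c (fun=> r) x)%:R)%:E) = ((2 * r) ^+ k)%:E.
  by rewrite intRd_box// prodr_const card_ord.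
have lo : ((p x0 / 2 * (2 * r) ^+ k)%:E <=
    intRd (fun x : 'rV[R]_k => (p x * (box c (fun=> r) x)%:R)%:E))%E.
  rewrite EFinM -Ibox -intRdZ//; last by rewrite divr_ge0// ltW.
  apply: intRd_le => x; rewrite lee_fin.
    by rewrite mulr_ge0// divr_ge0// ltW.
  have [/hbox[h1 _ _]|_] := boolP (box _ _ _); last by rewrite !mulr0.
  by rewrite !mulr1 ltW.
have up : (intRd (fun x : 'rV[R]_k => (p x * (box c (fun=> r) x)%:R)%:E) <=
    (2 * p x0 * (2 * r) ^+ k)%:E)%E.
  rewrite EFinM -Ibox -intRdZ//; last by rewrite mulr_ge0// ltW.
  apply: intRd_le => x; rewrite lee_fin.
    by rewrite mulr_ge0// ltW.
  have [/hbox[_ h1 _]|_] := boolP (box _ _ _); last by rewrite !mulr0.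
  by rewrite !mulr1 ltW.
have half : 2 * p x0 * (2 * r) ^+ k <= 2^-1.
  have : (2 * r) ^+ k <= 2 * r.
    rewrite -[leRHS]expr1 ler_wiXn2l//; first by rewrite mulr_ge0// ltW.
    by lra.
  have px0 := p0 x0.
  have : 8 * p x0 * r <= 1 by rewrite -ler_pdivlMl ?mulr_gt0// mulr1.
  by move=> h1 h2; nra.
case E : (intRd _) lo up => [m| |] //; rewrite !lee_fin => lo up.
exists r, m, b; split => //.
- by rewrite r0.
- rewrite (le_trans up half) andbT; apply: lt_le_trans lo.
  by rewrite mulr_gt0 ?divr_gt0// exprn_gt0// mulr_gt0.
- by move=> x /hbox[_ _ /ltW].
Unshelve. all: by end_near.
Qed.

(** The first coordinate of the drift is at least [sigma ^+ 2 * b / (2 * lam)], itself at least [4],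
    while [x] and [y] differ by at most [2] there. Hence [y] misses the proposal mean by at least
    half that drift. *)
Lemma mala_proposal_far (R : realType) (k : nat) (hk : (0 < k)%N)
    (p : 'rV[R]_k -> R) (sigma lam b : R) (x y : 'rV[R]_k) :
  (forall x, 0 < p x) -> (forall x, differentiable (fun z => ln (p z)) x) ->
  0 < sigma -> 0 < lam -> 0 < b ->
  b <= `|'D_(e1 R k) (fun z => ln (p z)) (scale_row lam x)| ->
  `|x ord0 (Ordinal hk)| <= 1 -> `|y ord0 (Ordinal hk)| <= 1 ->
  4 * lam <= sigma ^+ 2 / 2 * b ->
  mala_q sigma (scaled_density lam p) x y <=
  gauss_max k sigma * expR (- (sigma ^+ 2 * b ^+ 2 / 32 * lam^-1 ^+ 2)).
Proof.
move=> p0 dp s0 l0 b0 bD x1 y1 hl.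
have s2 : 0 < sigma ^+ 2 by rewrite exprn_gt0.
(* The exponent is that of a displacement [sigma ^+ 2 * b / (4 * lam)], half the minimal drift. *)
have -> : - (sigma ^+ 2 * b ^+ 2 / 32 * lam^-1 ^+ 2) =
    - (sigma ^+ 2 / 4 * b / lam) ^+ 2 / (2 * sigma ^+ 2).
  by field; rewrite !gt_eqF.
apply: (gauss_density_le_coord (i := Ordinal hk)) => //.
apply/andP; split; first by rewrite !mulr_ge0// ?invr_ge0// ltW.
rewrite mxE [X in _ - (_ + X)]mxE grad_log_scaled_density//.
set D := 'D_ _ _ _ in bD *.
have hD : sigma ^+ 2 / 2 * b / lam <= `|sigma ^+ 2 / 2 * (lam^-1 * D)|.
  have A0 : 0 < sigma ^+ 2 / 2 / lam by rewrite !divr_gt0.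
  by rewrite mulrA normrM (gtr0_norm A0) mulrAC ler_pM2l.
have h4 : 4 <= sigma ^+ 2 / 2 * b / lam by rewrite ler_pdivlMr.
set del := _ * (_ * D) in hD *.
have tri : `|del| <= `|y ord0 (Ordinal hk) - (x ord0 (Ordinal hk) + del)| +
    (`|y ord0 (Ordinal hk)| + `|x ord0 (Ordinal hk)|).
  rewrite -[X in `|X| <= _](_ : - (y ord0 (Ordinal hk) - (x ord0 (Ordinal hk) + del))
     + (y ord0 (Ordinal hk) - x ord0 (Ordinal hk)) = del); last by ring.
  apply: le_trans (ler_normD _ _) _; rewrite normrN lerD2l.
  exact: ler_normB.
have -> : sigma ^+ 2 / 4 * b / lam = (sigma ^+ 2 / 2 * b / lam) / 2.
  by field; rewrite gt_eqF.
lra.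
Qed.

Theorem theorem2p3 (R : realType) (d : nat) (hd : (0 < d)%N)
  (p : 'rV[R]_d -> R) (gamma beta sigma : R) :
  (forall x, 0 < p x) ->
  measurable_Rd p ->
  intRd (fun x => (p x)%:E) = 1%E ->
  C1 (fun x => ln (p x)) ->
  0 < gamma ->
  (exists c : R, 0 < c /\ exists M : R, forall x : 'rV[R]_d,
     M < `|x ord0 (Ordinal hd)| ->
     c <= `|'D_(e1 R d) (fun z => ln (p z)) x| * powR (norm2 x) gamma) ->
  0 < beta ->
  (exists C : R, exists M : R, forall t : R, M < t ->
     (intRd (fun x => (p x * ((t < norm2 x)%R)%:R)%:E) * (expR (powR t beta))%:E
       <= C%:E)%E) ->
  0 < sigma ->
  let alpha := Num.min (Num.min (beta / 2) (beta / gamma)) (2 / 3) in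
  exists C : R, exists2 delta : R, 0 < delta &
    forall lam : R, 0 < lam < delta ->
      (Gap (scaled_density lam p) (mala_q sigma (scaled_density lam p))
         * (expR (powR lam (- alpha)))%:E <= C%:E)%E.
Proof.
move=> p0 _ Ip [dp cD] gamma0 [c0 [c00 [M hM]]] beta0 [C [M' htail]] sigma0 alpha.
have cp := positive_log_continuous p0 dp.
have mp : row_measurable p by exact: continuous_row_measurable.
(* The first coordinate exceeds [M], so a zero derivative at [x0] would contradict the positive
   lower bound [c0]. *)
pose c (n : nat) : R := if n == 0%N then `|M| + 1 else 0.
pose x0 : 'rV[R]_d := \row_(i < d) c (val i).
have Dx0 : 'D_(e1 R d) (fun z => ln (p z)) x0 != 0.
  apply/eqP => D0; have := hM x0; rewrite D0 normr0 mul0r mxE /c /=.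
  rewrite ger0_norm ?addr_ge0// => /(_ _).
  have := ler_norm M => ? /(_ ltac:(lra)); lra.
have [r [m [b [/andP[r0 r2] /andP[m0 m2] b0 Im hb]]]] :=
  exists_small_box hd p0 cp (cD (e1 R d)) Dx0.
pose kappa := sigma ^+ 2 * b ^+ 2 / 32.
have s2 : 0 < sigma ^+ 2 by rewrite exprn_gt0.
have kappa0 : 0 < kappa by rewrite !mulr_gt0// exprn_gt0.
pose K := gauss_max d sigma.
have K0 : 0 < K by exact: gauss_max_gt0.
have M0 : 0 < `|M| + 2 by rewrite ltr_pwDr.
have M'0 : 0 < `|M'| + 1 by rewrite ltr_pwDr.
have d41 : 0 < 4 * d%:R + 1 :> R by rewrite ltr_wpDl// mulr_ge0.
(* In order: [lam < 1]; the contracted box has first coordinates at most [1] in modulus; [lam^-1]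
   lies beyond the tail threshold [M']; the drift is at least [4]; the Gaussian factor beats the
   volume. *)
pose delta := Num.min (Num.min 1 (`|M| + 2)^-1)
  (Num.min (Num.min (`|M'| + 1)^-1 (sigma ^+ 2 / 2 * b / 4)) (kappa / (4 * d%:R + 1))).
have m1 : 0 < m < 1 by rewrite m0 /=; lra.
have mm0 : 0 < m * (1 - m) by case/andP: m1 => *; rewrite mulr_gt0 ?subr_gt0.
(* [C] pays for the tail term and [1] for the Gaussian term. *)
exists (K * (C + 1) / (m * (1 - m))), delta.
  by rewrite !lt_min ltr01 !invr_gt0 M0 M'0 !divr_gt0 ?mulr_gt0 ?divr_gt0.
move=> lam /andP[l0]; rewrite !lt_min -!andbA => /and5P[l1 lM lM' ls lk].
pose u := lam^-1.
have u0 : 0 < u by rewrite invr_gt0.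
have uM' : M' < u.
  apply: le_lt_trans (ler_norm _) _; rewrite /u -[ltLHS]invrK.
  have [->|nz] := eqVneq M' 0; first by rewrite normr0 !invr0 invr_gt0.
  rewrite ltf_pV2 ?posrE ?invr_gt0 ?normr_gt0//.
  apply: lt_le_trans lM' _; rewrite lef_pV2 ?posrE ?normr_gt0//.
  by rewrite lerDl.
have {}htail := htail u uM'.
set tailI := intRd _ in htail.
have tail0 : (0 <= tailI)%E.
  by apply: iter_int_ge0 => x; rewrite lee_fin mulr_ge0// ltW.
(* An infinite tail mass times a positive exponential would exceed [C]. *)
have [tau tauE] : exists tau : R, tailI = tau%:E.
  move: htail tail0; case: tailI => [t _ _|h _|//]; first by exists t.
  by rewrite mulyr gtr0_sg ?expR_gt0// mul1e in h.
rewrite tauE -EFinM lee_fin in htail.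
have tau0 : 0 <= tau by rewrite -lee_fin -tauE.
pose pl := scaled_density lam p.
pose q := mala_q sigma pl.
pose J (x : 'rV[R]_d) := box c (fun=> r) (scale_row lam x).
pose F (x : 'rV[R]_d) := (u < norm2 (scale_row lam x))%R.
(* A cube containing all points outside [F]: their coordinates are at most [u] in modulus, and
   radius [2 * u] makes the inequality strict. Its volume is [(4 * u) ^+ d]. *)
pose N (x : 'rV[R]_d) := box (fun=> 0) (fun=> 2 * u) x.
pose eps := expR (- (kappa * u ^+ 2)).
have pl0 x : 0 < pl x by rewrite mulr_gt0 ?invr_gt0.
have mbox := @row_measurable_box R d c (fun=> r).
have mfar : row_measurable (fun x : 'rV[R]_d => (u < norm2 x)%R%:R).
  apply: row_measurable_ltr; last exact: row_measurable_norm2.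
  by move=> d' T z mz; exact: measurable_cst.
have mJ : row_measurable (fun x => (J x)%:R) by exact: (row_measurable_scale lam mbox).
have mF : row_measurable (fun x => (F x)%:R) by exact: (row_measurable_scale lam mfar).
have mN : row_measurable (fun x => (N x)%:R) by exact: row_measurable_box.
have mpl : row_measurable pl.
  by apply: row_measurableZ; exact: (row_measurable_scale lam mp).
have pge0 x : 0 <= p x by exact: ltW.
have Ipl : intRd (fun x => (pl x)%:E) = 1%E by rewrite -Ip -(intRd_scale hd l0 pge0).
have IplJ : intRd (fun x => (pl x * (J x)%:R)%:E) = m%:E.
  rewrite -Im -(intRd_scale hd l0 (g := fun x => p x * (box c (fun=> r) x)%:R)).
  - by congr (intRd _); apply/funext => x; rewrite /pl /scaled_density mulrA.
  - by move=> x; rewrite mulr_ge0.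
  - exact: row_measurableM.
have IplF : intRd (fun x => (pl x * (F x)%:R)%:E) = tau%:E.
  rewrite -tauE /tailI -(intRd_scale hd l0 (g := fun x => p x * (u < norm2 x)%R%:R)).
  - by congr (intRd _); apply/funext => x; rewrite /pl /scaled_density mulrA.
  - by move=> x; rewrite mulr_ge0.
  - exact: row_measurableM.
pose a := lam * (2 * r) ^+ d.
have IJ : intRd (fun x => ((J x)%:R)%:E) = a%:E.
  (* Inserting [lam * lam^-1] exposes the Jacobian needed for the change of variables. *)
  transitivity (intRd (fun x => (lam * (lam^-1 * (J x)%:R))%:E)).
    by congr (intRd _); apply/funext => x; rewrite mulrA mulfV ?gt_eqF// mul1r.
  rewrite intRdZ ?(ltW l0)//.
  - rewrite (intRd_scale hd l0 (g := fun x => (box c (fun=> r) x)%:R))//.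
    by rewrite intRd_box// prodr_const card_ord.
  - by move=> x; rewrite mulr_ge0// invr_ge0 ltW.
  - exact: row_measurableZ.
pose V := (4 * u) ^+ d.
have IN : intRd (fun x => ((N x)%:R)%:E) = V%:E.
  rewrite intRd_box => [|_]; last by rewrite mulr_gt0.
  by rewrite prodr_const card_ord mulrA -natrM.
have normS (y : 'rV[R]_d) (i : 'I_d) : ~~ F y -> `|scale_row lam y ord0 i| <= u.
  by rewrite -leNgt; apply: le_trans; exact: ler_norm_norm2.
have first_le1 (y : 'rV[R]_d) : ~~ F y -> `|y ord0 (Ordinal hd)| <= 1.
  move=> Fy; have := normS y (Ordinal hd) Fy.
  rewrite mxE /= normrM normfV (gtr0_norm l0) => h.
  by rewrite -(ler_pM2r u0) mul1r.
have FN (y : 'rV[R]_d) : ~~ F y -> N y.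
  move=> Fy; apply/forallP => i; rewrite subr0.
  have u1 : 1 < u by rewrite /u invf_gt1.
  have := normS y i Fy; have := first_le1 y Fy; rewrite mxE.
  case: ifP => [/eqP i0|_] h1 h2; last by lra.
  have -> : i = Ordinal hd by apply/val_inj.
  by lra.
have JFq x y : J x -> ~~ F y -> q x y <= K * eps.
  move=> Jx Fy; apply: (mala_proposal_far (hk := hd) (b := b)) => //.
  - exact: hb.
  - move/forallP: Jx => /(_ (Ordinal hd)); rewrite mxE /c /=.
    set w := x _ _ => hw.
    have : `|w / lam| <= `|M| + 2.
      have -> : w / lam = (w / lam - (`|M| + 1)) + (`|M| + 1) by ring.
      apply: le_trans (ler_normD _ _) _.
      rewrite (@ger0_norm _ (`|M| + 1)) ?addr_ge0//; lra.
    rewrite normrM normfV (gtr0_norm l0) ler_pdivrMr// => h.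
    apply: le_trans h _; rewrite -ler_pdivlMl// mulr1; exact: ltW.
  - exact: first_le1.
  - by rewrite mulrC -ler_pdivlMr// ltW.
have gap : (Gap pl q <= (K * (a * tau + eps * V) / (m * (1 - m)))%:E)%E.
  apply: (@mh_gap_le_indicator R d pl q J F N K eps m a tau V) => //.
  - by move=> x y; exact: gauss_density_gt0.
  - by move=> x y; exact: gauss_density_le_max.
  - exact: expR_ge0.
  - exact: open_scaled_box.
set E := expR _.
have E0 : 0 < E by exact: expR_gt0.
apply: le_trans (lee_wpmul2r _ gap) _; first by rewrite lee_fin ltW.
rewrite -EFinM lee_fin mulrAC ler_pM2r ?invr_gt0// -mulrA ler_pM2l// mulrDl.
have l01 : 0 < lam < 1 by rewrite l0.
(* Tail term: [a <= 1], and [alpha <= beta / 2 <= beta] lets the tail hypothesis at [u] absorb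
   [E]. *)
apply: lerD.
  have a1 : a <= 1.
    rewrite mulr_ile1 ?(ltW l0) ?(ltW l1) ?exprn_ge0 ?mulr_ge0 ?(ltW r0)//.
    by rewrite exprn_ile1 ?mulr_ge0 ?(ltW r0)//; lra.
  apply: le_trans htail.
  apply: (@le_trans _ _ (tau * E)).
    by rewrite ler_pM2r// ler_piMl.
  rewrite ler_wpM2l// ler_expR; apply: powR_opp_le => //.
  rewrite /alpha !ge_min; apply/orP; left; apply/orP; left; lra.
(* Gaussian term: [alpha <= 2 / 3 <= 1] gives [E <= expR u], which the Gaussian factor absorbs
   together with the volume [V]. *)
apply: le_trans (gauss_beats_volume (kappa := kappa) (k := d) (ltW u0) _); last first.
  by rewrite ltr_pdivlMr// in lk; rewrite ler_pdivlMr// mulrC ltW.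
rewrite ler_wpM2l ?mulr_ge0 ?expR_ge0 ?exprn_ge0 ?mulr_ge0 ?(ltW u0)//.
rewrite ler_expR -[leRHS](powRr1 (ltW u0)); apply: powR_opp_le => //.
by rewrite /alpha ge_min; apply/orP; right; lra.
Qed.
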